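(* Let $p,q$ be integers with $p\geq q\geq 3$ and let $C=G_{p,q}\subseteq S_{p+q}$ be the natural $(p,q)$-type group. Then $$L_{max}(C)= p+q-\left\lceil \frac{\sqrt{4q+1}-1}{2}\right\rceil.$$
   Context: For a positive integer $n$, $[n]=\{1,\dots,n\}$ and $S_n$ is the symmetric group on $[n]$. The $l_\infty$-metric on $S_n$ is $d(f,g)=\max_{i\in[n]}|f(i)-g(i)|$. For a nonempty $C\subseteq S_n$ and $f\in S_n$, $d(f,C)=\min_{g\in C}d(f,g)$. The covering radius $r(C)$ is the minimum integer $r$ such that $d(f,C)\le r$ for all $f\in S_n$. For $\pi\in S_n$, the relabeling of $C$ by $\pi$ is $C^{\pi}=\pi C\pi^{-1}=\{\pi g\pi^{-1}: g\in C\}$, where products are compositions of maps, so that conjugating a cycle $(a_1,\dots,a_k)$ by $\pi$ gives $(\pi(a_1),\dots,\pi(a_k))$. Define $L_{max}(C)=\max_{\pi\in S_n}r(C^{\pi})$. For positive integers $p,q$, the natural $(p,q)$-type group is the subgroup $G_{p,q}=\langle(1,2,\dots,p),(p+1,p+2,\dots,p+q)\rangle\subseteq S_{p+q}$ generated by the two displayed cycles (cycle notation, where each entry is mapped to the next one and the last to the first). *)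

(* Defs.v *)
From HB Require Import structures.
From mathcomp Require Import all_boot all_order all_fingroup all_algebra.
From mathcomp Require Import reals.

Set Implicit Arguments.
Unset Strict Implicit.
Unset Printing Implicit Defensive.

(* S_n is {perm 'I_n}, so points are numbered from 0; the shift by one affects
   neither the l_infty distance nor the covering radii below. *)

Definition linf_dist n (f g : {perm 'I_n}) : nat :=
  \max_(i < n) absz ((f i)%:Z - (g i)%:Z)%R.

(* The minimum over g in C; for n > 0 the neutral value n exceeds every distance
   on S_n, hence is only attained when C is empty. *)
Definition linf_dist_set n (f : {perm 'I_n}) (C : {set {perm 'I_n}}) : nat :=
  \big[minn/n]_(g in C) linf_dist f g.

Definition covered_within n (C : {set {perm 'I_n}}) (r : nat) : bool :=
  [forall f : {perm 'I_n}, linf_dist_set f C <= r].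

Lemma ex_covered_within n (C : {set {perm 'I_n}}) :
  exists r, covered_within C r.
Proof.
exists n; apply/forallP => f; rewrite /linf_dist_set.
by elim/big_rec: _ => // g d _ led; rewrite geq_min led orbT.
Qed.

Definition covering_radius n (C : {set {perm 'I_n}}) : nat :=
  ex_minn (ex_covered_within C).

(* g ^ pi = pi^-1 * g * pi, and products of permutations apply the left factor
   first, so g ^ pi is the map x |-> pi (g (pi^-1 x)). *)
Definition relabeling n (C : {set {perm 'I_n}}) (pi : {perm 'I_n}) :
  {set {perm 'I_n}} := [set (g ^ pi)%g | g in C].

Definition Lmax n (C : {set {perm 'I_n}}) : nat :=
  \max_(pi : {perm 'I_n}) covering_radius (relabeling C pi).

Lemma next_inj (T : eqType) (s : seq T) : uniq s -> injective (next s).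
Proof. by move=> Us; apply: can_inj (prev_next Us). Qed.

(* The cycle (a_1, ..., a_k) for s = [:: a_1; ...; a_k]: next s fixes the
   points outside s. *)
Definition cycle_perm (T : finType) (s : seq T) (Us : uniq s) : {perm T} :=
  perm (next_inj Us).

Lemma uniq_lshift p q : uniq [seq lshift q i | i <- enum 'I_p].
Proof. by rewrite (map_inj_uniq (@lshift_inj p q)) enum_uniq. Qed.

Lemma uniq_rshift p q : uniq [seq rshift p j | j <- enum 'I_q].
Proof. by rewrite (map_inj_uniq (@rshift_inj p q)) enum_uniq. Qed.

(* enum 'I_p is increasing, so the two sequences are 0, ..., p-1 and
   p, ..., p+q-1. *)
Definition natural_group p q : {set {perm 'I_(p + q)}} :=
  <<[set cycle_perm (uniq_lshift p q); cycle_perm (uniq_rshift p q)]>>%g.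

(* Main.v *)
Require Import Defs.
From HB Require Import structures.
From mathcomp Require Import all_boot all_order all_fingroup all_algebra.
From mathcomp Require Import reals.
From mathcomp Require Import zify lra.

Set Implicit Arguments.
Unset Strict Implicit.
Unset Printing Implicit Defensive.

(* Write n = p + q and let k be the least integer with q <= k (k + 1), which is
   the ceiling in the theorem. There are k (k + 1) ordered pairs of points at
   distance at least n - k, and a permutation f is at distance at least n - k from a relabeled
   group iff, on one of its two orbits, every rotation moves some point far away
   from its image under f. Each pair of far points rules out at most one rotation
   of an orbit, so with k - 1 in place of k fewer than q <= p rotations are ruled
   out and both orbits have a good one. Conversely, on the orbit of length q the
   k (k + 1) far pairs can be arranged to rule out every rotation: the far pairs
   form two triangles with rows of lengths 1, ..., k, whose rows are paired up
   into blocks of w = k or k + 1 consecutive rotations, k blocks covering Z/q. *)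

(** * Elements of the natural group as pairs of rotations *)

Lemma next_enum_ord n (m : 'I_n) : next (enum 'I_n) m = ordS m.
Proof.
case: n m => [[]//|n] m; rewrite next_nth mem_enum /=.
case E: (enum _) => [|y s]; first by have := size_enum_ord n.+1; rewrite E.
have Ey : y = ord0 by apply: val_inj; have /= := nth_enum_ord ord0 (ltn0Sn n); rewrite E.
rewrite -E index_enum_ord -[nth y s m]/(nth y (y :: s) m.+1) -E; apply: val_inj => /=.
have [lt|ge] := ltnP m n; first by rewrite nth_enum_ord // modn_small.
have -> : m = n :> nat by have := ltn_ord m; lia.
by rewrite nth_default ?size_enum_ord // Ey modnn.
Qed.

Lemma val_iter_ordS n (m : 'I_n) i : iter i (@ordS n) m = (m + i) %% n :> nat.
Proof.
elim: i => [|i IH] /=; first by rewrite addn0 modn_small.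
by rewrite IH -addn1 modnDml addn1 addnS.
Qed.

Lemma cycle_perm_map n (T : finType) (c : 'I_n -> T)
    (Us : uniq [seq c i | i <- enum 'I_n]) m :
  injective c -> cycle_perm Us (c m) = c (ordS m).
Proof. by move=> Ic; rewrite permE next_map ?enum_uniq // next_enum_ord. Qed.

Lemma cycle_perm_out (T : finType) (s : seq T) (Us : uniq s) x :
  x \notin s -> cycle_perm Us x = x.
Proof. by move=> xs; rewrite permE next_nth (negPf xs). Qed.

Section NaturalGroup.

Variables p q : nat.
Let a := cycle_perm (uniq_lshift p q).
Let b := cycle_perm (uniq_rshift p q).

Let a_l m : a (lshift q m) = lshift q (ordS m).
Proof. exact/cycle_perm_map/lshift_inj. Qed.
Let b_r m : b (rshift p m) = rshift p (ordS m).
Proof. exact/cycle_perm_map/rshift_inj. Qed.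
Let a_r m : a (rshift p m) = rshift p m.
Proof.
by apply/cycle_perm_out/mapP => -[x _ /eqP]; rewrite eq_rlshift.
Qed.
Let b_l m : b (lshift q m) = lshift q m.
Proof.
by apply/cycle_perm_out/mapP => -[x _ /eqP]; rewrite eq_lrshift.
Qed.

Definition rotates i j (g : {perm 'I_(p + q)}) :=
  (forall m, g (lshift q m) = lshift q (iter i (@ordS p) m)) /\
  (forall m, g (rshift p m) = rshift p (iter j (@ordS q) m)).

Let rotates_gen i j : rotates i j (a ^+ i * b ^+ j)%g.
Proof.
split=> m; rewrite permM !permX.
  have -> : iter i a (lshift q m) = lshift q (iter i (@ordS p) m).
    by elim: i => //= i ->.
  by elim: j => //= j ->.
have -> : iter i a (rshift p m) = rshift p m by elim: i => //= i ->.
by elim: j => //= j ->.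
Qed.

Let natural_groupE : natural_group p q = (<[a]> * <[b]>)%g.
Proof.
have cab : commute a b.
  apply/permP => x; rewrite !permM.
  by case: (split_ordP x) => m ->; rewrite ?a_l ?a_r ?b_l ?b_r ?a_l ?a_r.
rewrite -cent_joinEr; last by rewrite cent_cycle cycle_subG; apply/cent1P.
by rewrite joing_idl joing_idr.
Qed.

Lemma natural_group_rotates g :
  g \in natural_group p q -> exists i j, rotates i j g.
Proof.
by rewrite natural_groupE => /mulsgP[_ _ /cycleP[i ->] /cycleP[j ->] ->]; exists i, j.
Qed.

Lemma rotates_natural_group i j : exists2 g, g \in natural_group p q & rotates i j g.
Proof.
by exists (a ^+ i * b ^+ j)%g; rewrite // natural_groupE mem_mulg ?mem_cycle.
Qed.

End NaturalGroup.

(** * Distances, covering radii and the upper bound *)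

Section CoveringRadius.

Variable n : nat.
Implicit Types (C : {set {perm 'I_n}}) (f g phi pi : {perm 'I_n}).

(** Reindexing by [pi] leaves [g] unconjugated: [phi] and [pi] become two labelings of the original
    points. Every permutation has the form [pi^-1 * phi]. *)
Lemma linf_dist_conj phi pi g :
  linf_dist (pi^-1 * phi)%g (g ^ pi)%g =
  \max_(z < n) absz ((phi z)%:Z - (pi (g z))%:Z)%R.
Proof.
rewrite /linf_dist (reindex_inj (@perm_inj _ pi)) /=.
by apply: eq_bigr => z _; rewrite permJ permM permK.
Qed.

Lemma linf_dist_set_le f C g : g \in C -> linf_dist_set f C <= linf_dist f g.
Proof.
rewrite /linf_dist_set -big_filter => gC.
have : g \in [seq x <- index_enum _ | x \in C] by rewrite mem_filter gC mem_index_enum.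
elim: [seq _ <- _ | _] => // h s IH; rewrite inE big_cons geq_min.
by case: eqP => [->|_ /IH ->]; rewrite ?leqnn ?orbT.
Qed.

(** The bound [r <= n] handles the default value [n] of the minimum. *)
Lemma leq_linf_dist_set f C r :
  r <= n -> (forall g, g \in C -> r <= linf_dist f g) ->
  r <= linf_dist_set f C.
Proof.
by move=> rn rC; apply: (big_ind (fun d => r <= d)) => // x y; rewrite leq_min => -> ->.
Qed.

Lemma covering_radius_leP C r :
  reflect (forall f, linf_dist_set f C <= r) (covering_radius C <= r).
Proof.
rewrite /covering_radius; case: ex_minnP => m /forallP cm minm.
apply: (iffP idP) => [mr f|cr]; first exact: leq_trans (cm f) mr.
by apply/minm/forallP.
Qed.

End CoveringRadius.

(* If every rotation failed, the far pairs witnessing this would be distinct. The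
   far pairs (u, v) with u < v and those with v < u form two triangles, which
   [code] fits together into a k by k + 1 rectangle. *)
Lemma exists_near_rotation n r k (c : 'I_r -> 'I_n) (phi pi : {perm 'I_n}) :
  injective c -> 0 < k -> k <= n -> k * k.+1 < r ->
  exists i, forall m,
    absz ((phi (c m))%:Z - (pi (c (iter i (@ordS r) m)))%:Z)%R < n - k.
Proof.
move=> Ic k0 kn kr; pose far (i m : 'I_r) :=
  (n - k <= absz ((phi (c m))%:Z - (pi (c (iter i (@ordS r) m)))%:Z)%R).
have [/existsP[i /forallP ni]|] := boolP [exists i, [forall m, ~~ far i m]].
  by exists i => m; rewrite ltnNge ni.
rewrite negb_exists => /forallP allfar; exfalso.
have ex_far i : exists m, far i m.
  by have := allfar i; rewrite negb_forall => /existsP[m]; rewrite negbK; exists m.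
pose x i := xchoose (ex_far i).
have xP i : far i (x i) by apply: xchooseP.
case: k k0 kn kr @far allfar ex_far @x xP => // k _ kn kr far _ ex_far x xP.
pose u i := phi (c (x i)); pose v (i : 'I_r) := pi (c (iter i (@ordS r) (x i))).
have uvP i : (n - k.+1 <= absz ((u i)%:Z - (v i)%:Z)%R) := xP i.
pose code (i : 'I_r) : 'I_k.+1 * 'I_k.+2 :=
  if (u i < v i) then (inord (u i), inord (n.-1 - v i))
  else (inord (k - v i), inord (k.+1 - (n.-1 - u i))).
suff : injective code by move/leq_card; rewrite card_prod !card_ord leqNgt kr.
move=> i j ecode.
have [euv evv] : u i = u j /\ v i = v j.
  suff [/val_inj eu /val_inj ev] : u i = u j :> nat /\ v i = v j :> nat by [].
  have := (uvP j, uvP i, ltn_ord (u i), ltn_ord (v i), ltn_ord (u j), ltn_ord (v j)).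
  move=> -[[[[[Pj Pi] Hui] Hvi] Huj] Hvj]; move: ecode.
  (* The coordinates of [code] sum to at most [k] in its first branch and to at least [k.+1] in its
     second, so the mixed cases are contradictory. *)
  rewrite /code; case: ifP => Hi; case: ifP => Hj [];
    move=> /(congr1 val) /= + /(congr1 val) /=; rewrite !inordK; lia.
have exx : x i = x j by apply/Ic/(@perm_inj _ phi).
move/perm_inj/Ic/(congr1 val): evv => /=; rewrite !val_iter_ordS exx => /eqP.
by rewrite eqn_modDl !modn_small // => /eqP/val_inj.
Qed.

(** Points are added one at a time; a transposition corrects the image of the new point and fixes
    the images already prescribed. *)
Lemma exists_perm_extension (T : finType) (A : {pred T}) (h : T -> T) :
  {in A &, injective h} -> exists s : {perm T}, {in A, s =1 h}.
Proof.
move=> Ih.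
suff [s sh] : exists s : {perm T}, {in enum A, s =1 h}.
  by exists s => x xA; apply: sh; rewrite mem_enum.
have sA : {subset enum A <= A} by move=> x; rewrite mem_enum.
elim: (enum A) (enum_uniq A) sA => [|x l IH] /=; first by exists 1%g.
case/andP=> xl /IH{}IH sA.
have [|s sl] := IH; first by move=> y yl; apply: sA; rewrite inE yl orbT.
exists (s * tperm (s x) (h x))%g => y; rewrite inE permM => /predU1P[->|yl].
  by rewrite tpermL.
have yx : y != x by apply: contraNneq xl => <-.
rewrite tpermD; first exact: sl.
  by rewrite (inj_eq perm_inj) eq_sym.
rewrite sl // eq_sym; apply: contra yx => /eqP /Ih -> //; apply: sA.
  by rewrite inE yl orbT.
exact: mem_head.
Qed.

(** Good rotations of the two orbits are chosen independently and combined into one group element.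
    Here [k.+1] is the ceiling of the theorem. *)
Lemma covering_radius_relabeling_le p q k (pi : {perm 'I_(p + q)}) :
  0 < k -> k * k.+1 < q -> q <= p ->
  covering_radius (relabeling (natural_group p q) pi) <= (p + q) - k.+1.
Proof.
move=> k0 kq qp; apply/covering_radius_leP => f.
have kn : k <= p + q by nia.
have [i Hi] := exists_near_rotation (pi * f) pi (@lshift_inj p q) k0 kn (leq_trans kq qp).
have [j Hj] := exists_near_rotation (pi * f) pi (@rshift_inj p q) k0 kn kq.
have [g gG [gl gr]] := rotates_natural_group p q i j.
apply: leq_trans (linf_dist_set_le f (imset_f (conjg^~ pi) gG)) _.
rewrite -[f](mulKg pi) linf_dist_conj; apply/bigmax_leqP => z _.
rewrite -ltnS -subSn ?subSS; last by nia.
by case: (split_ordP z) => m ->; rewrite ?gl ?gr.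
Qed.

(** * Arrangement of the far pairs and the lower bound *)

(** The right side lies strictly between two consecutive multiples of [w]. *)
Lemma mul_neq_mul_sub m i l w : 0 < i -> 0 < l < w -> m * w != i * w - l.
Proof.
move=> i0 lw; have iw := leq_pmull w i0.
by have [lt|le] := ltnP m i; [have := leq_mul lt (leqnn w) | have := leq_mul le (leqnn w)];
  rewrite ?mulSn; lia.
Qed.

Section FarLabels.

Variables n q k w : nat.
Hypotheses (k_gt1 : 1 < k) (le_kw : k <= w) (le_wk : w <= k.+1).
Hypotheses (lt_kwq : k * w.-1 < q) (le_qkw : q <= k * w) (le_qn : q + q <= n).

Let lt_kq : k < q. Proof. nia. Qed.

(* A label v is placed at position label_pos v of the orbit, and a value u at
   position q - 1 - value_shift u, so that u faces v under the rotation by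
   label_pos v + value_shift u + 1 modulo q. *)
Definition label_pos v := if v < w.-1 then w + v else n.-1 - v.

Definition is_label v := (v < w.-1) || (n - k <= v < n).

Definition value_shift u :=
  if u < k then u * w else
  let len := k - (n.-1 - u) in
  (* The labels far below [u] are those [v < len]; they are to fill the end of block [len + k - w].
     For block 0 the shift [- len] is taken modulo [q]. *)
  if len + k == w then q - len else (len + k - w) * w - len.

(** The last condition says that the row of [u] has length less than [w]; it drops only [n.-1], and
    only when [w = k]. *)
Definition is_value u := (u < k) || (n - k <= u < n) && (k < w + (n.-1 - u)).

(** The largest position is [2 * w.-1], at most [k * w.-1] because [1 < k]. *)
Lemma label_pos_lt v : is_label v -> label_pos v < q.
Proof. rewrite /is_label /label_pos; case: ifP => /=; nia. Qed.

Lemma label_pos_inj : {in is_label &, injective label_pos}.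
Proof.
move=> v v'; rewrite !unfold_in /is_label /label_pos.
by case: ifP => /=; case: ifP => /=; lia.
Qed.

Lemma value_shift_lt u : is_value u -> value_shift u < q.
Proof.
rewrite /is_value /value_shift; case: ifP => /= [uk _|_ H]; first by nia.
case: ifP => E; first by lia.
move: H E; set i := n.-1 - u => H E.
have : k - i <= k by lia.
have : 0 < k - i by lia.
nia.
Qed.

Let high_shift l := if l + k == w then q - l else (l + k - w) * w - l.

(** Lengthening a row by [d] raises its shift by [d * w.-1], except from block 0, whose shift
    [q - l] exceeds all the others. *)
Let high_shift_neq l l' : 0 < l < l' -> l' <= k -> l' < w -> high_shift l != high_shift l'.
Proof.
move=> /andP[l0 ll'] l'k l'w; rewrite /high_shift.
have -> : (l' + k == w) = false by lia.
case: ifP => E; first by have := leq_mul (_ : l' + k - w <= k.-1) (leqnn w); nia.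
have [a a0 Ea] : exists2 a, 0 < a & l + k - w = a by eexists; last reflexivity; lia.
have [d d0 Ed] : exists2 d, 0 < d & l' = l + d by exists (l' - l); lia.
have -> : l' + k - w = a + d by lia.
have := leq_pmull w a0; have : d * 2 <= d * w by rewrite leq_mul2l; lia.
by rewrite Ea Ed mulnDl; lia.
Qed.

Let high_shift_low_neq u l : u < k -> 0 < l < w -> l <= k -> u * w != high_shift l.
Proof.
move=> uk lw lk; rewrite /high_shift; case: ifP => E; first by nia.
by apply: mul_neq_mul_sub => //; lia.
Qed.

Lemma value_shift_inj : {in is_value &, injective value_shift}.
Proof.
have highE u : value_shift u = if u < k then u * w else high_shift (k - (n.-1 - u)) by [].
have high u : is_value u -> ~~ (u < k) -> let l := k - (n.-1 - u) in
    [&& 0 < l, l < w, l <= k & u == n.-1 - (k - l)].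
  by rewrite /is_value; lia.
move=> u u' Vu Vu'; rewrite !highE.
case: ifPn => [Hu|/(high _ Vu)]; case: ifPn => [Hu'|/(high _ Vu')] /=.
- by move=> /eqP; rewrite eqn_pmul2r; lia.
- move=> /and4P[l0 lw lk _] /eqP; rewrite (negPf (high_shift_low_neq _ _ _)) //.
  by rewrite l0.
- move=> /and4P[l0 lw lk _] /eqP; rewrite eq_sym (negPf (high_shift_low_neq _ _ _)) //.
  by rewrite l0.
move: (k - _) (k - (n.-1 - u)) => l' l /and4P[l'0 l'w l'k /eqP->] /and4P[l0 lw lk /eqP->] /eqP.
have [lt|lt|-> //] := ltngtP l l'.
  by rewrite (negPf (high_shift_neq _ _ _)) ?l0.
by rewrite eq_sym (negPf (high_shift_neq _ _ _)) ?l'0.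
Qed.

(* Block i consists of the rotations r with i * w <= r < i.+1 * w. The first k - i
   of them are excluded by the low value i against high labels, the others by a
   high value against low labels. *)
Lemma far_value_label r : r < q ->
  exists u v, [/\ is_value u, is_label v,
    n - k <= absz (u%:Z - v%:Z)%R &
    label_pos v + value_shift u = r \/ label_pos v + value_shift u = r + q].
Proof.
move=> rq; have w0 : 0 < w by lia.
have Er := divn_eq r w; have ow := ltn_pmod r w0.
move: (r %/ w) (r %% w) Er ow => i o Er ow.
have ik : i < k by nia.
have [oki|koi] := ltnP o (k - i).
  exists i, (n.-1 - o); rewrite /is_value /is_label /label_pos /value_shift ik /=.
  have -> : (n.-1 - o < w.-1) = false by lia.
  by split; lia.
(* This value has row length [i + w - k], the number of rotations left in block [i]. *)
exists (n.-1 - (k + k - w - i)), (o - (k - i)).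
rewrite /is_value /is_label /label_pos /value_shift.
have -> : (n.-1 - (k + k - w - i) < k) = false by lia.
have -> : (o - (k - i) < w.-1) = true by lia.
have -> : k - (n.-1 - (n.-1 - (k + k - w - i))) = i + w - k by lia.
split=> //=; try lia.
have [i0|i_gt0] := posnP i.
  by right; rewrite Er i0 mul0n; case: ifP; lia.
left; have -> : i + w - k + k - w = i by lia.
by have := leq_pmull w i_gt0; case: ifP; lia.
Qed.

End FarLabels.

Lemma exists_far_labeling n q k (c : 'I_q -> 'I_n) :
  injective c -> 1 < k -> k * k.-1 < q -> q <= k * k.+1 -> q + q <= n ->
  exists phi pi : {perm 'I_n}, forall j, exists m,
    n - k <= absz ((phi (c m))%:Z - (pi (c (iter j (@ordS q) m)))%:Z)%R.
Proof.
move=> Ic k1 kq qk qn.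
pose w := if q <= k * k then k else k.+1.
have kw : k <= w by rewrite /w; case: ifP; lia.
have wk : w <= k.+1 by rewrite /w; case: ifP; lia.
have kwq : k * w.-1 < q by rewrite /w; case: (leqP q (k * k)).
have qkw : q <= k * w by rewrite /w; case: (leqP q (k * k)).
move: w kw wk kwq qkw => w kw wk kwq qkw.
have q0 : 0 < q by lia.
case: q q0 c Ic kq qk qn kwq qkw => // q _ c Ic kq qk qn kwq qkw.
pose A := [pred v : 'I_n | is_label n k w v].
pose B := [pred u : 'I_n | is_value n k w u].
have lpos := label_pos_lt k1 kw wk kwq qkw qn.
have vpos := value_shift_lt k1 kw wk kwq qkw qn.
have [|s sE] := @exists_perm_extension _ A (fun v => c (inord (label_pos n w v))).
  move=> v v' Av Av' /Ic/(congr1 val); rewrite /= !inordK ?lpos // => E.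
  exact/val_inj/(label_pos_inj k1 kw wk kwq qkw qn).
have [|t tE] := @exists_perm_extension _ B
    (fun u => c (inord (q - value_shift n q.+1 k w u))).
  move=> u u' Bu Bu' /Ic/(congr1 val); have := vpos _ Bu; have := vpos _ Bu'.
  rewrite /= !inordK; try lia; move=> lt' lt E.
  apply/val_inj/(value_shift_inj k1 kw wk kwq qkw qn) => //=; lia.
exists t^-1%g, s^-1%g => j.
(* The orbit length is now [q.+1], so [j + q] stands for [j - 1], undoing the extra 1 in the
   rotation that makes [u] face [v]. *)
have rq : (j + q) %% q.+1 < q.+1 by rewrite ltn_mod.
have [u [v [Bu Av far sum]]] := far_value_label k1 kw wk kwq qkw qn rq.
have un : u < n by move: Bu; rewrite /is_value; lia.
have vn : v < n by move: Av; rewrite /is_label; lia.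
have lt_e := vpos _ Bu.
exists (inord (q - value_shift n q.+1 k w u)).
have -> : iter j (@ordS q.+1) (inord (q - value_shift n q.+1 k w u)) =
    inord (label_pos n w v).
  apply: ord_inj; rewrite val_iter_ordS !inordK ?lpos //; last by lia.
  have -> : label_pos n w v = label_pos n w v %% q.+1 by rewrite modn_small ?lpos.
  apply/eqP; rewrite -(eqn_modDr (value_shift n q.+1 k w u)).
  have -> : q - value_shift n q.+1 k w u + j + value_shift n q.+1 k w u = j + q by lia.
  by case: sum => ->; rewrite ?modnDr modn_mod.
have := tE (Ordinal un) Bu => /= <-; have := sE (Ordinal vn) Av => /= <-.
by rewrite !permK.
Qed.

(** The witness [pi^-1 * phi] is far from every conjugate because each group element rotates the
    orbit of length [q] by some [j]. *)
Lemma covering_radius_relabeling_ge p q k :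
  1 < k -> k * k.-1 < q -> q <= k * k.+1 -> q <= p ->
  exists pi, p + q - k <= covering_radius (relabeling (natural_group p q) pi).
Proof.
move=> k1 kq qk qp; have qn : q + q <= p + q by rewrite leq_add2r.
have [phi [pi far]] := exists_far_labeling (@rshift_inj p q) k1 kq qk qn.
exists pi; have /covering_radius_leP/(_ (pi^-1 * phi)%g) := leqnn
  (covering_radius (relabeling (natural_group p q) pi)).
apply: leq_trans; apply: leq_linf_dist_set; first exact: leq_subr.
move=> _ /imsetP[g /natural_group_rotates[i [j [_ gr]]] ->].
have [m farm] := far j; rewrite linf_dist_conj; apply: leq_trans farm _.
by rewrite -gr (leq_bigmax (rshift p m)).
Qed.

Lemma Lmax_natural_group p q k :
  1 < k -> k * k.-1 < q -> q <= k * k.+1 -> q <= p ->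
  Lmax (natural_group p q) = p + q - k.
Proof.
move=> k1 kq qk qp; apply/eqP; rewrite eqn_leq; apply/andP; split.
  apply/bigmax_leqP => pi _; case: k k1 kq {qk} => // k k1 kq.
  by apply: covering_radius_relabeling_le => //; rewrite mulnC.
have [pi le_pi] := covering_radius_relabeling_ge k1 kq qk qp.
exact: leq_trans le_pi (leq_bigmax pi).
Qed.

(** * Evaluation of the ceiling and conclusion *)

Import Order.TTheory GRing.Theory Num.Theory.

Local Open Scope ring_scope.

(** As [4k(k-1) + 1 = (2k-1)^2] and [4k(k+1) + 1 = (2k+1)^2], the root lies in the interval from
    [2k-1] (excluded) to [2k+1] (included). *)
Lemma ceil_sqrt_oblong (R : realType) (q k : nat) :
  (0 < k)%N -> (k * k.-1 < q)%N -> (q <= k * k.+1)%N ->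
  Num.ceil ((Num.sqrt (4 * q + 1)%N%:R - 1) / 2 : R) = k%:Z.
Proof.
case: k => // k _ kq qk; apply: ceil_def.
have le_sqrt (m : nat) : (Num.sqrt (4 * q + 1)%N%:R <= m%:R :> R) = (4 * q + 1 <= m ^ 2)%N.
  by rewrite -[m%:R]normr_nat -sqrtr_sqr ler_sqrt ?sqr_ge0 // -natrX ler_nat.
have := le_sqrt (2 * k + 1)%N; have := le_sqrt (2 * (k + 1) + 1)%N.
have -> : (4 * q + 1 <= (2 * (k + 1) + 1) ^ 2)%N by rewrite !expnS expn0; nia.
have -> : (4 * q + 1 <= (2 * k + 1) ^ 2)%N = false by rewrite !expnS expn0; nia.
move=> + /negbT; rewrite -ltNge.
have -> : k.+1%:Z - 1 = k%:Z by lia.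
rewrite -!pmulrn -[k.+1]addn1 !(natrD, natrM) => le1 lt2.
by apply/andP; split; lra.
Qed.

Theorem mainTheorem2 (R : realType) (p q : nat) (hq : (3 <= q)%N)
    (hpq : (q <= p)%N) :
  (Lmax (natural_group p q))%:Z =
  (p + q)%N%:Z - Num.ceil ((Num.sqrt (4 * q + 1)%N%:R - 1) / 2 : R).
Proof.
have exk : exists k, (q <= k * k.+1)%N by exists q; rewrite leq_pmulr.
case: (ex_minnP exk) => k qk mink.
(* For [k <= 1] the product [k * k.+1] is at most 2, below [q]. *)
have k1 : (1 < k)%N by case: k qk {mink} => [|[|k]]; lia.
have kq : (k * k.-1 < q)%N.
  rewrite ltnNge; apply/negP => le; have := mink k.-1.
  by rewrite prednK ?(mulnC k.-1) // => [/(_ le)|]; lia.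
rewrite (Lmax_natural_group k1 kq qk hpq) (ceil_sqrt_oblong R _ kq qk); nia.
Qed.
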